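(* Fix a natural number $m$. The logic $LTL_{Past,m}$ is decidable with respect to admissible rules: there is an algorithm which, for any given inference rule, verifies whether it is admissible in $LTL_{Past,m}$.
   Context: Formulas are built from propositional letters by Boolean connectives, the unary operation $\mathbf{N}$ (next) and the binary operation $\mathbf{S}$ (since). Fix a natural number $m$. A frame is $\langle \mathbb{N},\geq,\mathrm{Next},\bigcup_{i\in\mathbb{N}}R_i\rangle$ where $R_i$ is the order $\geq$ restricted to the interval $[i,i+m]$ (so $b\,R_a\,a$ iff $a\le b\le a+m$). A model is such a frame with a valuation $V$ assigning to each letter a subset of $\mathbb{N}$. Truth: letters via $V$; Boolean connectives as usual; $(\mathcal{M},a)\models\mathbf{N}\varphi$ iff $(\mathcal{M},a+1)\models\varphi$; $(\mathcal{M},a)\models\varphi\,\mathbf{S}\,\psi$ iff there is $b$ with $b\,R_a\,a$, $(\mathcal{M},b)\models\psi$ and $(\mathcal{M},c)\models\varphi$ for all $c$ with $a\le c<b$. $LTL_{Past,m}$ is the set of formulas true at all states of all such models. An inference rule $\varphi_1(x_1,\dots,x_n),\dots,\varphi_l(x_1,\dots,x_n)/\psi(x_1,\dots,x_n)$ is admissible in a logic $L$ if for every tuple of formulas $\alpha_1,\dots,\alpha_n$: if $\varphi_i(\alpha_1,\dots,\alpha_n)\in L$ for all $i$, then $\psi(\alpha_1,\dots,\alpha_n)\in L$. *)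

(* Defs.v *)
From mathcomp Require Import all_boot.

Set Implicit Arguments.
Unset Strict Implicit.
Unset Printing Implicit Defensive.

Inductive form : Type :=
  | Var of nat
  | Neg of form
  | And of form & form
  | Or of form & form
  | Imp of form & form
  | Next of form
  | Since of form & form.

(* [acc m i b a] is b R_i a: the order >= restricted to [i, i + m]. *)
Definition acc (m i b a : nat) : bool :=
  [&& i <= b <= i + m, i <= a <= i + m & a <= b].

(* [V x a] means that the state [a] belongs to the set assigned to the letter
   [x]; the frame is determined by [m]. *)
Fixpoint sat (m : nat) (V : nat -> nat -> Prop) (a : nat) (phi : form) : Prop :=
  match phi with
  | Var x => V x a
  | Neg p => ~ sat m V a p
  | And p q => sat m V a p /\ sat m V a q
  | Or p q => sat m V a p \/ sat m V a q
  | Imp p q => sat m V a p -> sat m V a q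
  | Next p => sat m V a.+1 p
  | Since p q => exists b : nat,
      [/\ acc m a b a, sat m V b q
        & forall c : nat, a <= c < b -> sat m V c p]
  end.

Definition LTL_Past (m : nat) (phi : form) : Prop :=
  forall (V : nat -> nat -> Prop) (a : nat), sat m V a phi.

Fixpoint subst (s : nat -> form) (phi : form) : form :=
  match phi with
  | Var x => s x
  | Neg p => Neg (subst s p)
  | And p q => And (subst s p) (subst s q)
  | Or p q => Or (subst s p) (subst s q)
  | Imp p q => Imp (subst s p) (subst s q)
  | Next p => Next (subst s p)
  | Since p q => Since (subst s p) (subst s q)
  end.

(* The variables x_1, ..., x_n of a rule are the letters occurring in it. *)
Record rule : Type := Rule { premises : seq form; conclusion : form }.

Definition admissible (L : form -> Prop) (r : rule) : Prop :=
  forall s : nat -> form,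
    (forall i : 'I_(size (premises r)),
       L (subst s (tnth (in_tuple (premises r)) i))) ->
    L (subst s (conclusion r)).

(* Algorithms are partial recursive functions: a statement of the form
   [{P} + {~ P}] or [exists f : T -> bool, ...] would be classically trivial. *)
Inductive recfun : nat -> Type :=
  | RZero n : recfun n
  | RSucc : recfun 1
  | RProj n of 'I_n : recfun n
  | RComp k n of recfun k & ('I_k -> recfun n) : recfun n
  | RPrec n of recfun n & recfun n.+2 : recfun n.+1
  | RMu n of recfun n.+1 : recfun n.

(* [computes p v y]: the program [p] halts on the arguments [v] with value [y].
   In the primitive recursion case [w] lists the successive values of the
   recursion; minimization requires all earlier values to be defined. *)
Fixpoint computes n (p : recfun n) : n.-tuple nat -> nat -> Prop :=
  match p in recfun n return n.-tuple nat -> nat -> Prop with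
  | RZero _ => fun _ y => y = 0
  | RSucc => fun v y => y = (thead v).+1
  | RProj _ i => fun v y => y = tnth v i
  | RComp k _ f g => fun v y => exists w : k.-tuple nat,
      (forall i : 'I_k, computes (g i) v (tnth w i)) /\ computes f w y
  | RPrec n f g => fun v y => exists w : nat -> nat,
      [/\ computes f [tuple of behead v] (w 0),
          forall x : nat, x < thead v ->
            computes g [tuple of x :: w x :: behead v] (w x.+1)
        & y = w (thead v)]
  | RMu n f => fun v y =>
      computes f [tuple of y :: v] 0 /\
      forall x : nat, x < y ->
        exists z : nat, computes f [tuple of x :: v] z.+1
  end.

Lemma computes_fun n (p : recfun n) (v : n.-tuple nat) (y z : nat) :
  computes p v y -> computes p v z -> y = z.
Proof.
elim: p v y z => /= {n}.
- by move=> n v y z -> ->.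
- by move=> v y z -> ->.
- by move=> n i v y z -> ->.
- move=> k n f IHf g IHg v y z [w [gw fw]] [w' [gw' fw']].
  have E : w = w' by apply: eq_from_tnth => i; apply: IHg (gw i) (gw' i).
  by rewrite -E in fw'; apply: IHf fw fw'.
- move=> n f IHf g IHg v y z [w [w0 wS ->]] [w' [w0' wS' ->]].
  have E x : x <= thead v -> w x = w' x.
    elim: x => [_|x IHx ltx]; first exact: IHf w0 w0'.
    move: (wS' x ltx); rewrite -(IHx (ltnW ltx)).
    exact: IHg (wS x ltx).
  exact: E.
- move=> n f IHf v y z [fy ly] [fz lz].
  case: (ltngtP y z) => // lt.
  + by have [k fk] := lz _ lt; have := IHf _ _ _ fy fk.
  + by have [k fk] := ly _ lt; have := IHf _ _ _ fz fk.
Qed.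

(* Cantor pairing *)
Definition cpair (a b : nat) : nat := ((a + b) * (a + b).+1)./2 + b.

Fixpoint code_form (phi : form) : nat :=
  match phi with
  | Var x => cpair 0 x
  | Neg p => cpair 1 (code_form p)
  | And p q => cpair 2 (cpair (code_form p) (code_form q))
  | Or p q => cpair 3 (cpair (code_form p) (code_form q))
  | Imp p q => cpair 4 (cpair (code_form p) (code_form q))
  | Next p => cpair 5 (code_form p)
  | Since p q => cpair 6 (cpair (code_form p) (code_form q))
  end.

Definition code_forms (s : seq form) : nat :=
  foldr (fun phi c => (cpair (code_form phi) c).+1) 0 s.

Definition code_rule (r : rule) : nat :=
  cpair (code_forms (premises r)) (code_form (conclusion r)).

Lemma cpair_inj (a b c d : nat) : cpair a b = cpair c d -> a = c /\ b = d.
Proof.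
have T n : (n.+1 * n.+2)./2 = (n * n.+1)./2 + n.+1.
  have -> : n.+1 * n.+2 = n * n.+1 + n.+1.*2.
    by rewrite -addn2 mulnDr muln2 mulnC.
  by rewrite halfD odd_double andbF doubleK.
have M i j : i <= j -> (i * i.+1)./2 <= (j * j.+1)./2.
  by move=> le; apply: half_leq; apply: leq_mul.
have L i j k l : i + j < k + l -> cpair i j < cpair k l.
  move=> lt; rewrite /cpair; apply: leq_trans (leq_addr _ _).
  apply: leq_trans (M _ _ lt); rewrite T ltn_add2l ltnS; exact: leq_addl.
move=> E; case: (ltngtP (a + b) (c + d)) => [lt|lt|Es].
- by have := L _ _ _ _ lt; rewrite E ltnn.
- by have := L _ _ _ _ lt; rewrite E ltnn.
- move: E; rewrite /cpair Es => /addnI bd; split=> //.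
  by move: Es; rewrite bd => /addIn.
Qed.

Lemma code_form_inj : injective code_form.
Proof.
elim=> [x|p IHp|p IHp q IHq|p IHp q IHq|p IHp q IHq|p IHp|p IHp q IHq] [] //=.
all: try by [move=> > /cpair_inj[] | move=> > /cpair_inj[_ ->]
  | move=> > /cpair_inj[_ /IHp ->]
  | move=> > /cpair_inj[_ /cpair_inj[/IHp -> /IHq ->]]].
Qed.

Lemma code_rule_inj : injective code_rule.
Proof.
have F : injective code_forms.
  elim=> [|p s IHs] [|q t] //= /succn_inj /cpair_inj[/code_form_inj -> /IHs ->].
  by [].
by move=> [s p] [t q] /cpair_inj[/= /F -> /code_form_inj ->].
Qed.

(* Main.v *)
Require Import Defs.
From mathcomp Require Import all_boot.
From mathcomp Require Import boolp.

(* The truth of a formula at a state depends only on a bounded window of letters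
   ahead of it, so a substitution is a sliding block code defined on a full
   shift, and the premises of a rule define a shift of finite type X. The image
   of a full shift is irreducible and contains a constant sequence. Hence the
   rule is not admissible iff some walk in the graph of windows of X leads from
   a constant window to one refuting the conclusion and back; conversely such a
   closed walk is the image of a full shift in one letter, by writing it out
   whenever a marker 1 0 ... 0 comes into sight and staying at the constant
   window otherwise. Closing the walk into a cycle whose length is a computable
   function of the rule, its existence becomes that of a number coding a finite
   table of truth values, subject to conditions with bounded quantifiers. *)

Set Implicit Arguments.
Unset Strict Implicit.
Unset Printing Implicit Defensive.

(** * Truth values *)

(** [Since] looks at most [m] states ahead, so over a Boolean valuation truth is itself Boolean;
    here [b] and [c] are offsets from [a]. *)
Fixpoint ev (m : nat) (V : nat -> nat -> bool) (a : nat) (phi : form) : bool :=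
  match phi with
  | Var x => V x a
  | Neg p => ~~ ev m V a p
  | And p q => ev m V a p && ev m V a q
  | Or p q => ev m V a p || ev m V a q
  | Imp p q => ev m V a p ==> ev m V a q
  | Next p => ev m V a.+1 p
  | Since p q => has (fun b => ev m V (a + b) q &&
      all (fun c => ev m V (a + c) p) (iota 0 b)) (iota 0 m.+1)
  end.

Lemma satP m (V : nat -> nat -> bool) a phi :
  reflect (sat m (fun x t => V x t) a phi) (ev m V a phi).
Proof.
elim: phi a => [x|p IHp|p IHp q IHq|p IHp q IHq|p IHp q IHq|p IHp|p IHp q IHq] a /=.
- exact: idP.
- by apply: (iffP negP) => H /IHp.
- by apply: (iffP andP) => -[/IHp ? /IHq].
- by apply: (iffP orP) => -[/IHp|/IHq]; [left|right|left|right].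
- by apply: (iffP implyP) => H /IHp/H/IHq.
- exact: IHp.
apply: (iffP (@hasP _ _ (iota 0 m.+1))) => [[b]|[b]].
  rewrite mem_iota ltnS /= => bm /andP[/IHq qb /allP pc].
  exists (a + b); split=> //.
    by rewrite /acc leq_addr leq_add2l bm leqnn leq_addr.
  move=> c /andP[ac cb]; apply/IHp; rewrite -(subnKC ac); apply: pc.
  by rewrite mem_iota /= ltn_subLR.
rewrite /acc => -[/and3P[/andP[_ bm] _ ab] /IHq qb pc].
exists (b - a); first by rewrite mem_iota ltnS /= leq_subLR.
rewrite subnKC // qb; apply/allP => c; rewrite mem_iota ltn_subRL /= => cb.
by apply/IHp/pc; rewrite leq_addr cb.
Qed.

Lemma sat_ext m (V W : nat -> nat -> Prop) a phi :
  (forall x t, V x t <-> W x t) -> sat m V a phi <-> sat m W a phi.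
Proof.
move=> VW.
elim: phi a => [x|p IHp|p IHp q IHq|p IHp q IHq|p IHp q IHq|p IHp|p IHp q IHq] a /=.
- exact: VW.
- by split=> H /IHp.
- by split=> -[/IHp ? /IHq].
- by split=> -[/IHp|/IHq]; [left|right|left|right].
- by split=> H /IHp/H/IHq.
- exact: IHp.
by split=> -[b [ab /IHq qb pc]]; exists b; split=> // c /pc/IHp.
Qed.

(** Classically every valuation is Boolean, through [asbool], and [sat] respects pointwise
    equivalence of valuations. *)
Lemma LTL_PastE m phi :
  LTL_Past m phi <-> (forall V a, ev m V a phi).
Proof.
split=> [H V a|H V a]; first exact/satP/H.
apply/(sat_ext _ _ _ (W := fun x t => `[< V x t >])); last exact/satP/H.
by move=> x t; split=> /asboolP.
Qed.

Lemma ev_subst m V s phi a :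
  ev m V a (subst s phi) = ev m (fun x t => ev m V t (s x)) a phi.
Proof.
elim: phi a => //= [p IHp|p IHp q IHq|p IHp q IHq|p IHp q IHq|p IHp q IHq] a;
  rewrite ?IHp ?IHq //.
congr orb; apply: eq_has => b; rewrite IHq; congr andb; apply: eq_all => c.
exact: IHp.
Qed.

(* Bounds both the letters of [phi] and how far ahead of a state its truth
   value looks. *)
Fixpoint radius (m : nat) (phi : form) : nat :=
  match phi with
  | Var x => x
  | Neg p => radius m p
  | And p q | Or p q | Imp p q => maxn (radius m p) (radius m q)
  | Next p => (radius m p).+1
  | Since p q => m + maxn (radius m p) (radius m q)
  end.

Lemma ev_local m n V W a b phi : radius m phi <= n ->
  (forall x i, x <= n -> i <= n -> V x (a + i) = W x (b + i)) ->
  ev m V a phi = ev m W b phi.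
Proof.
move=> rn VW.
(* An offset [k] is carried along, so that [Next] and [Since] can move ahead at the expense of the
   remaining radius. *)
suff H k : k + radius m phi <= n -> ev m V (a + k) phi = ev m W (b + k) phi.
  by rewrite -[a]addn0 -[b]addn0 H.
elim: phi k {rn} =>
    [x|p IHp|p IHp q IHq|p IHp q IHq|p IHp q IHq|p IHp|p IHp q IHq] k /= kn.
- by apply: VW; [apply: leq_trans kn; apply: leq_addl
               | apply: leq_trans kn; apply: leq_addr].
- by rewrite IHp.
- by move: kn; rewrite addn_maxr geq_max => /andP[/IHp-> /IHq->].
- by move: kn; rewrite addn_maxr geq_max => /andP[/IHp-> /IHq->].
- by move: kn; rewrite addn_maxr geq_max => /andP[/IHp-> /IHq->].
- by rewrite -!addnS IHp // addSnnS.
apply: (@eq_in_has _ _ _ (iota 0 m.+1)) => j; rewrite mem_iota ltnS /= => jm.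
have le i : i <= j ->
    k + i + radius m p <= n /\ k + i + radius m q <= n.
  move=> ij; split; apply: leq_trans kn; rewrite -addnA leq_add2l;
    apply: leq_add (leq_trans ij jm) _; [exact: leq_maxl|exact: leq_maxr].
rewrite -!addnA IHq; last by case: (le j).
congr andb; apply: eq_in_all => c; rewrite mem_iota /= => /ltnW cj.
by rewrite -!addnA IHp //; case: (le c).
Qed.

Lemma leq_cpair a b : a + b <= cpair a b.
Proof.
rewrite /cpair leq_add2r; case: a => [|a] //.
rewrite -{1}[a.+1]doubleK; apply: half_leq.
by rewrite -muln2 leq_mul ?leq_addr // addSn.
Qed.

Lemma cpair_ge a b : (a <= cpair a b) /\ (b <= cpair a b).
Proof.
by split; apply: leq_trans (leq_cpair a b); rewrite ?leq_addr ?leq_addl.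
Qed.

Lemma ltn_cpair t x : 0 < t -> x < cpair t x.
Proof.
case: t => // t _; apply: leq_trans (leq_cpair _ _).
by rewrite addSn ltnS leq_addl.
Qed.

(** A connective adds at most [m.+1] to the radius, while pairing with a nonzero tag raises the code
    by at least 1. This makes the look-ahead bounded by a computable function of the code. *)
Lemma leq_radius_code m phi : radius m phi <= m.+1 * code_form phi.
Proof.
have le1 k p t : 0 < t -> k <= m.+1 * p -> m.+1 + k <= m.+1 * cpair t p.
  move=> t0 kp; apply: (@leq_trans (m.+1 * p.+1)).
    by rewrite mulnS leq_add2l.
  by rewrite leq_mul2l ltn_cpair // orbT.
have le2 k l p q t : 0 < t -> k <= m.+1 * p -> l <= m.+1 * q ->
    m.+1 + maxn k l <= m.+1 * cpair t (cpair p q).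
  move=> t0 kp lq; apply: le1 => //; rewrite geq_max; case: (cpair_ge p q) => pp qq.
  by rewrite (leq_trans kp) ?(leq_trans lq) // leq_mul2l ?pp ?qq orbT.
elim: phi => [x|p IHp|p IHp q IHq|p IHp q IHq|p IHp q IHq|p IHp|p IHp q IHq] /=.
- by rewrite mulSn (leq_trans _ (leq_addr _ _)) //; case: (cpair_ge 0 x).
- by apply: leq_trans (le1 _ _ 1 _ IHp) => //; apply: leq_addl.
- by apply: leq_trans (le2 _ _ _ _ 2 _ IHp IHq) => //; apply: leq_addl.
- by apply: leq_trans (le2 _ _ _ _ 3 _ IHp IHq) => //; apply: leq_addl.
- by apply: leq_trans (le2 _ _ _ _ 4 _ IHp IHq) => //; apply: leq_addl.
- by apply: leq_trans (le1 _ _ 5 _ IHp) => //; rewrite addSn ltnS leq_addl.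
- by apply: leq_trans (le2 _ _ _ _ 6 _ IHp IHq) => //; rewrite addSn leqnSn.
Qed.

(** * Rules refuted on a cycle *)

(** Both connecting paths can be taken simple, so together they are shorter than twice the number of
    vertices; the remaining length, at least [pad], is spent on the loop at [c]. *)
Lemma periodic_walk (W : finType) (e : rel W) (c w : W) pad L :
  2 * #|W| + pad <= L -> e c c -> connect e c w -> connect e w c ->
  exists f : nat -> W, [/\ forall i, e (f i) (f i.+1),
    forall i, f (i + L) = f i, forall i, i <= pad -> f i = c
    & exists q, f q = w].
Proof.
move=> leL ecc /connectP[p0 ep0 lp0] /connectP[q0 eq0 lq0].
have card (x : W) s : uniq (x :: s) -> size s < #|W|.
  move=> u; rewrite -[_ < _]/(size (x :: s) <= _) -(card_uniqP u).
  exact: max_card.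
case/shortenP: ep0 lp0 => p ep /card sp _ lp {p0}.
case/shortenP: eq0 lq0 => q eq /card sq _ lq {q0}.
pose k := L - (size p + size q).
have spq : size p + size q + pad <= L.
  by apply: leq_trans leL; rewrite mul2n -addnn leq_add2r leq_add // ltnW.
have pad_k : pad <= k by rewrite leq_subRL // (leq_trans _ spq) ?leq_addr.
have eL : k + (size p + size q) = L.
  by rewrite subnK // (leq_trans _ spq) ?leq_addr.
have L0 : 0 < L.
  by apply: leq_trans leL; rewrite addn_gt0 muln_gt0 (leq_trans _ sp).
pose s := nseq k c ++ p ++ q.
have ss : size s = L by rewrite !size_cat size_nseq.
have ls : last c (nseq k c) = c by case: (k) => //= j; elim: j.
have es : path e c s.
  rewrite !cat_path ls ep -lp eq !andbT.
  by elim: (k) => //= j ->; rewrite ecc.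
have lsc : last c s = c by rewrite !last_cat ls -lp -lq.
(* The list [c :: s] has [L.+1] entries and [c] at both ends, so reducing the index modulo [L]
   closes the walk. *)
pose f i := nth c (c :: s) (i %% L).
exists f; split=> [i|i|i ik|].
- have iL := ltn_pmod i L0.
  have := pathP c es (i %% L); rewrite ss => /(_ iL).
  rewrite /f -(addn1 i) -modnDml addn1.
  have := iL; rewrite leq_eqVlt => /orP[/eqP E|lt].
    suff -> : nth c s (i %% L) = c by rewrite E modnn.
    by rewrite -[RHS]lsc -nth_last ss -[X in _ = nth _ _ X.-1]E.
  by rewrite (modn_small lt).
- by rewrite /f modnDr.
- rewrite /f; have := ik; rewrite leq_eqVlt => _.
  have := leq_mod i L => /leq_trans/(_ ik).
  case: (i %% L) => //= j jk; rewrite nth_cat size_nseq (leq_trans jk) //.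
  by rewrite nth_nseq (leq_trans jk).
exists (k + size p).
have le : k + size p <= L by rewrite -eL leq_add2l leq_addr.
have nthw : nth c (c :: s) (k + size p) = w.
  rewrite lp -[in RHS]ls -last_cat (last_nth c) size_cat size_nseq /s catA.
  by rewrite -[LHS]/(nth c ((c :: nseq k c ++ p) ++ q) _) nth_cat /= size_cat
    size_nseq ltnS leqnn.
(* If [q] is empty, the position [k + size p] is [L] and wraps around to 0. *)
rewrite /f; move: le; rewrite leq_eqVlt => /orP[/eqP E|lt].
  by rewrite E modnn /= -nthw E -[LHS]lsc (last_nth c) ss.
by rewrite modn_small.
Qed.

(** Bounds the letters and the look-ahead of all formulas of the rule at once, and depends on the
    rule only through its code. *)
Definition window m (r : rule) := m.+1 * code_rule r.

(* Enough for two shortest walks in the graph of the [2 ^ ((n + 1) * (n + 1))]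
   windows, followed by a constant stretch. *)
Definition period n := 2 * 2 ^ (n.+1 * n.+1) + n.+2.

(** The constant stretch at the start of the cycle fills a whole window; it will allow a walk to
    wait at state 0 arbitrarily long. *)
Definition refutable m (r : rule) := exists V,
  [/\ forall x a, V x (a + period (window m r)) = V x a,
      forall x a, x <= window m r -> a <= window m r -> V x a = V x 0,
      forall i a, ev m V a (tnth (in_tuple (premises r)) i)
    & exists q, ~~ ev m V q (conclusion r)].

Lemma leq_code_forms s (i : 'I_(size s)) :
  code_form (tnth (in_tuple s) i) <= code_forms s.
Proof.
rewrite (tnth_nth (Var 0)) /=; case: i => i /=.
elim: s i => //= p s IH [_|i /IH le] /=;
  have [lp ls] := cpair_ge (code_form p) (code_forms s).
- exact: leqW lp.
- exact: leqW (leq_trans le ls).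
Qed.

Lemma code_rule_ge r :
  code_forms (premises r) <= code_rule r /\
  code_form (conclusion r) <= code_rule r.
Proof. exact: cpair_ge. Qed.

Lemma leq_code_premise r i :
  code_form (tnth (in_tuple (premises r)) i) <= code_rule r.
Proof. by apply: leq_trans (leq_code_forms i) _; case: (code_rule_ge r). Qed.

Lemma radius_premise m r i :
  radius m (tnth (in_tuple (premises r)) i) <= window m r.
Proof.
apply: leq_trans (leq_radius_code _ _) _; rewrite leq_mul2l /=.
exact: leq_code_premise.
Qed.

Lemma radius_conclusion m r : radius m (conclusion r) <= window m r.
Proof.
apply: leq_trans (leq_radius_code _ _) _; rewrite leq_mul2l /=.
by case: (code_rule_ge r).
Qed.

(** * From a refuting substitution to a cycle *)

Definition winval n (w : {ffun 'I_n.+1 * 'I_n.+1 -> bool}) (x i : nat) : bool :=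
  w (inord x, inord i).

Lemma not_admissible_refutable m r :
  ~ admissible (LTL_Past m) r -> refutable m r.
Proof.
move=> nadm; set n := window m r.
have [s [prem [V0 [a0 concl]]]] : exists s,
    (forall i V a, ev m V a (subst s (tnth (in_tuple (premises r)) i))) /\
    exists V a, ~~ ev m V a (subst s (conclusion r)).
  apply: contrapT => H; apply: nadm => s prem.
  apply/LTL_PastE => V a; apply/negPn/negP => nev; apply: H; exists s; split.
    by move=> i; apply/LTL_PastE.
  by exists V, a.
pose M := \max_(x < n.+1) radius m (s x).
have rM x : x <= n -> radius m (s x) <= M.
  by rewrite -ltnS => xn; apply: (leq_bigmax (Ordinal xn)).
(* [Z] copies the part of [V0] seen from [a0] and is false elsewhere. The shift [off] keeps this
   part out of sight of the states up to [n.+1], so that the windows at 0 and at 1 are both constant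
   in time and form a loop. *)
pose off := M + n.+2.
pose Z y t := (off <= t <= off + (n + M)) && V0 y (a0 + (t - off)).
pose X x t := ev m Z t (s x).
pose cst x := ev m (fun _ _ => false) 0 (s x).
have Xlo x t : x <= n -> t <= n.+1 -> X x t = cst x.
  move=> xn tn; apply: ev_local (rM x xn) _ => y i _ iM.
  rewrite /Z leqNgt (_ : t + i < off) // /off addnC -addnS leq_add //.
have Xhi x t : x <= n -> off + (n + M) < t -> X x t = cst x.
  move=> xn tn; apply: ev_local (rM x xn) _ => y i _ iM.
  by rewrite /Z [X in _ && X && _]leqNgt ltn_addr // andbF.
have Xmid x i : x <= n -> i <= n -> X x (off + i) = ev m V0 (a0 + i) (s x).
  move=> xn ni; apply: ev_local (rM x xn) _ => y j _ jM.
  by rewrite /Z -(addnA off) -(addnA a0) leq_addr leq_add2l leq_add //= addKn.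
pose W := {ffun 'I_n.+1 * 'I_n.+1 -> bool} : finType.
pose win t : W := [ffun p : 'I_n.+1 * 'I_n.+1 => X p.1 (t + p.2)].
have winE t x i : x <= n -> i <= n -> winval (win t) x i = X x (t + i).
  by move=> xn ni; rewrite /winval ffunE /= !inordK.
(* The graph of windows: the source satisfies the premises, and the target overlaps it after a shift
   by one state. *)
pose e (w w' : W) :=
  [forall i, ev m (winval w) 0 (tnth (in_tuple (premises r)) i)] &&
  [forall x : 'I_n.+1, forall i : 'I_n, winval w x i.+1 == winval w' x i].
have ewin t : e (win t) (win t.+1).
  apply/andP; split.
    apply/forallP => i; rewrite (@ev_local m n _ X 0 t) ?radius_premise //.
      by rewrite -ev_subst.
    by move=> x j xn jn; rewrite winE.
  apply/forallP => x; apply/forallP => i.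
  have xn : x <= n by rewrite -ltnS.
  by rewrite !winE // ?addSnnS // ltnW.
have con t k : connect e (win t) (win (t + k)).
  elim: k => [|k IH]; first by rewrite addn0 connect0.
  by apply: connect_trans IH _; rewrite addnS connect1.
have win_cst t : (t <= 1) || (off + (n + M) < t) -> win t = win 0.
  move=> tn; apply/ffunP => -[x i]; rewrite !ffunE /=.
  have xn : x <= n by rewrite -ltnS.
  have ni : i <= n by rewrite -ltnS.
  rewrite [RHS]Xlo ?leqW //; case/orP: tn => tn.
    by rewrite Xlo //; apply: leq_add tn ni.
  by rewrite Xhi // (leq_trans tn) ?leq_addr.
have ecc : e (win 0) (win 0) by rewrite -{2}(win_cst 1).
have c1 : connect e (win 0) (win off) by apply: con.
have c2 : connect e (win off) (win 0).
  by rewrite -(win_cst (off + (n + M).+1)) // addnS ltnSn orbT.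
have [|f [fe fL fc [q fq]]] := @periodic_walk W e _ _ n (period n) _ ecc c1 c2.
  rewrite /period card_ffun card_bool card_prod !card_ord leq_add2l.
  by rewrite ltnW.
(* The first column of each window suffices: by the overlaps, the window at [a] is the restriction
   of [V] to the states from [a] on. *)
pose V x a := winval (f a) x 0.
have VE x a i : x <= n -> i <= n -> winval (f a) x i = V x (a + i).
  move=> xn; elim: i a => [|i IH] a ni; first by rewrite addn0.
  have /andP[_ /forallP/(_ (Ordinal (xn : x < n.+1)))/forallP/(_ (Ordinal ni))] := fe a.
  by move=> /eqP ->; rewrite IH ?addSnnS // ltnW.
exists V; split=> [x a|x a xn an|i a|].
- by rewrite /V fL.
- by rewrite /V !fc.
- rewrite -(@ev_local m n (winval (f a)) _ 0) ?radius_premise //.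
    by have /andP[/forallP] := fe a.
  by move=> x j xn jn; rewrite VE.
exists q; rewrite -(@ev_local m n (winval (f q)) _ 0) ?radius_conclusion //;
  last by move=> x j xn jn; rewrite VE.
rewrite fq (@ev_local m n _ (fun x t => ev m V0 t (s x)) 0 a0) ?radius_conclusion //.
  by rewrite -ev_subst.
by move=> x i xn ni; rewrite winE ?Xmid.
Qed.

(** * From a cycle to a refuting substitution *)

Fixpoint block_form (n : nat) (g : seq bool -> bool) : form :=
  if n is k.+1 then
    Or (And (Var 0) (Next (block_form k (fun w => g (true :: w)))))
       (And (Neg (Var 0)) (Next (block_form k (fun w => g (false :: w)))))
  else if g [::] then Imp (Var 0) (Var 0) else Neg (Imp (Var 0) (Var 0)).

(** Every block code on one letter is thus definable: the formula is a decision tree on the next [n]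
    values of letter 0, with constant leaves. *)
Lemma ev_block_form m V n g a :
  ev m V a (block_form n g) = g [seq V 0 (a + i) | i <- iota 0 n].
Proof.
elim: n g a => [|n IH] g a /=.
  by case: (g [::]) => /=; rewrite implybb.
rewrite !IH addn0 (iotaDl 1 0) -map_comp.
rewrite (eq_map (g := fun i => V 0 (a.+1 + i))) => [|i /=]; last by rewrite addnA addn1.
by case: (V 0 a); rewrite /= ?orbF.
Qed.

(* A marker is a [true] followed by [L - 1] times [false]; markers are at least
   [L] apart. *)
Definition marker (L : nat) (w : nat -> bool) (t : nat) : bool :=
  w t && all (fun i => ~~ w (t + i).+1) (iota 0 L.-1).

(* Equal to 0 when no marker is in sight, as [find] then returns [L]. *)
Definition phase (L : nat) (w : nat -> bool) : nat :=
  L.-1 - find (marker L w) (iota 0 L).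

Lemma marker_ext L w w' t :
  (forall i, i < L -> w (t + i) = w' (t + i)) -> 0 < L ->
  marker L w t = marker L w' t.
Proof.
move=> ww L0; rewrite /marker -(addn0 t) ww //; congr andb.
apply: eq_in_all => i; rewrite mem_iota /= add0n => iL.
by rewrite -addnS addn0 ww // -(prednK L0) ltnS.
Qed.

(** A marker starting before [L] ends before [L + L], which fixes the block length of the
    substitution built below. *)
Lemma phase_ext L w w' : 0 < L -> (forall i, i < L + L -> w i = w' i) ->
  phase L w = phase L w'.
Proof.
move=> L0 ww; rewrite /phase; congr subn; apply: eq_in_find => t.
rewrite mem_iota /= => tL; apply: marker_ext => // i iL; apply: ww.
by rewrite -addSn leq_add // ltnW.
Qed.

(** Shifting [w] brings the first marker one step nearer, which raises the phase by one. After a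
    marker at position 0, the zeros following it put the next one at [L] or beyond, so the phase
    returns to 0. If no marker is in sight, one can only enter at the last position, again with
    phase 0. *)
Lemma phase_step L w : 0 < L ->
  phase L (fun t => w t.+1) = (phase L w).+1 %% L \/
  phase L w = 0 /\ phase L (fun t => w t.+1) = 0.
Proof.
move=> L0; rewrite /phase.
have mkS t : marker L (fun t => w t.+1) t = marker L w t.+1 by [].
set t := find (marker L w) _; set u := find _ (iota 0 L).
have tL : t <= L by rewrite -[X in _ <= X](size_iota 0 L) find_size.
have uL : u <= L by rewrite -[X in _ <= X](size_iota 0 L) find_size.
have ut : u < L -> marker L w u.+1.
  rewrite -[X in _ < X -> _](size_iota 0 L) -has_find => h.
  by have := nth_find 0 h; rewrite mkS nth_iota // -[X in _ < X](size_iota 0 L) -has_find.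
have tt : t < L -> marker L w t.
  rewrite -[X in _ < X -> _](size_iota 0 L) -has_find => h.
  by have := nth_find 0 h; rewrite nth_iota // -[X in _ < X](size_iota 0 L) -has_find.
have bt i : i < t -> marker L w i = false.
  by move=> it; have := before_find 0 it; rewrite nth_iota // (leq_trans it).
have bu i : i < u -> marker L w i.+1 = false.
  by move=> it; have := before_find 0 it; rewrite nth_iota // (leq_trans it).
have big : L.-1 <= u -> L.-1 - u = 0 by move=> le; apply/eqP.
move: tL; rewrite leq_eqVlt => /orP[/eqP tL|tL].
  right; rewrite tL; split; first by apply/eqP; rewrite subn_eq0 leq_pred.
  apply: big; rewrite leqNgt; apply/negP => lt.
  have uL' : u < L by apply: leq_trans lt (leq_pred _).
  move: (ut uL'); rewrite bt // tL -(prednK L0) ltnS //.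
left; case: (posnP t) => [t0|t0].
  rewrite t0 subn0 prednK // modnn; apply: big; rewrite leqNgt; apply/negP => lt.
  have uL' : u < L by apply: leq_trans lt (leq_pred _).
  have := tt tL; rewrite t0 => /andP[_ /allP/(_ u)].
  rewrite mem_iota /= => /(_ lt).
  by have /andP[-> _] := ut uL'.
have -> : u = t.-1.
  apply/eqP; rewrite eqn_leq; apply/andP; split; rewrite leqNgt; apply/negP => lt.
    by have := bu _ lt; rewrite prednK // tt.
  have uL' : u < L by apply: leq_trans lt (leq_trans (leq_pred _) (ltnW tL)).
  by have := ut uL'; rewrite bt // -ltn_predRL.
have -> : (L.-1 - t).+1 = L.-1 - t.-1.
  have lt : t.-1 < L.-1 by rewrite -ltnS !prednK.
  by rewrite -(subnSK lt) prednK.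
by rewrite modn_small // (leq_ltn_trans (leq_subr _ _)) // ltn_predL.
Qed.

(* [f] may linger at state 0 of the cycle, where [V] is constant. *)
Lemma lingering_cycle (V : nat -> bool) (f : nat -> nat) n L : n.+1 < L ->
  (forall a, V (a + L) = V a) -> (forall a, a <= n -> V a = V 0) ->
  (forall a, f a.+1 = (f a).+1 %% L \/ f a = 0 /\ f a.+1 = 0) ->
  forall a i, i <= n -> V (f (a + i)) = V (f a + i).
Proof.
move=> nL VL Vn fS a.
have Vmod b : V (b %% L) = V b.
  rewrite {2}(divn_eq b L) addnC; elim: (b %/ L) => [|k IH]; first by rewrite addn0.
  by rewrite mulSnr addnA VL.
(* Either [f] is in step with the uniform rotation, or it has lingered at 0, and then both positions
   lie in the constant stretch. *)
have H i : i <= n -> f (a + i) %% L = (f a + i) %% L \/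
    f (a + i) <= (f a + i) %% L <= i.
  elim: i => [|i IH] ni; first by rewrite !addn0; left.
  have small k : k <= i -> k.+1 < L.
    by move=> ki; apply: leq_ltn_trans nL; rewrite ltnS (leq_trans ki) // ltnW.
  rewrite !addnS -(addn1 (f a + i)) -modnDml.
  case: (IH (ltnW ni)) => [E|/andP[lo hi]]; case: (fS (a + i)) => [->|[f0 ->]].
  - by left; rewrite modn_mod -E modnDml addn1.
  - right; rewrite -E f0 mod0n add0n modn_small //.
    exact: leq_ltn_trans nL.
  - right; rewrite addn1; move: ((f a + i) %% L) lo hi => j lo hi.
    by rewrite !modn_small ?small ?ltnS ?lo //; apply: leq_trans lo hi.
  - by right; rewrite addn1 modn_small ?small.
move=> i ni; rewrite -[RHS]Vmod -[LHS]Vmod.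
case: (H i ni) => [->|/andP[lo hi]] //.
have ln := leq_trans hi ni.
by rewrite [RHS]Vn // Vmod Vn // (leq_trans lo).
Qed.

Lemma ltn_period n : n.+1 < period n.
Proof. by rewrite /period; apply: leq_addl. Qed.

(** Every phase occurs: the single [true] sits at [L.-1 - q] and starts the first marker. This
    reaches the state refuting the conclusion. *)
Lemma phase_delta L q : q < L -> phase L (fun i => q + i == L.-1) = q.
Proof.
move=> qL; have qL1 : q <= L.-1 by rewrite -ltnS prednK // (leq_trans _ qL).
have kL : L.-1 - q < L.
  by rewrite (leq_ltn_trans (leq_subr _ _)) // ltn_predL (leq_trans _ qL).
rewrite /phase -[X in iota 0 X](subnKC kL) addSnnS iotaD find_cat ifF.
  rewrite size_iota /= add0n ifT ?addn0 ?subKn //.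
  rewrite /marker subnKC // eqxx; apply/allP => i _.
  by rewrite -addSn addnA addnS subnKC // neq_ltn ltnS leq_addr orbT.
apply/hasPn => i; rewrite mem_iota /= => ik.
by rewrite /marker negb_and neq_ltn -ltn_subRL ik.
Qed.

Lemma refutable_not_admissible m r :
  refutable m r -> ~ admissible (LTL_Past m) r.
Proof.
move=> [V [VL Vc prem [q concl]]] adm.
set n := window m r in Vc; set L := period n in VL.
have nL : n.+1 < L := ltn_period n; clearbody L.
have L0 : 0 < L by apply: leq_ltn_trans nL.
pose s x := block_form (L + L) (fun w => V x (phase L (nth false w))).
pose f (Z : nat -> nat -> bool) a := phase L (fun i => Z 0 (a + i)).
have sE Z a x : ev m Z a (s x) = V x (f Z a).
  rewrite ev_block_form; congr (V x _); apply: phase_ext => // i iL.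
  by rewrite (nth_map 0) ?size_iota // nth_iota.
have fS Z a : f Z a.+1 = (f Z a).+1 %% L \/ f Z a = 0 /\ f Z a.+1 = 0.
  have -> : f Z a.+1 = phase L (fun t => (fun i => Z 0 (a + i)) t.+1).
    by apply: phase_ext => // i _; rewrite addSnnS.
  exact: phase_step.
(* Under any valuation [Z] the substituted letters show [V] along the phases, a cycle with
   lingering; so the premises, true all along [V], become theorems. *)
have substE Z a phi : radius m phi <= n ->
    ev m Z a (subst s phi) = ev m V (f Z a) phi.
  move=> rn; rewrite ev_subst; apply: ev_local rn _ => x i xn ni; rewrite sE.
  by apply: (@lingering_cycle (V x) _ n L) => // b; apply: Vc.
have /LTL_PastE/(_ (fun _ t => t == L.-1) (q %% L)) : LTL_Past m (subst s (conclusion r)).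
  apply: adm => i; apply/LTL_PastE => Z a.
  by rewrite substE ?prem // radius_premise.
rewrite substE ?radius_conclusion // /f phase_delta ?ltn_pmod //.
rewrite (@ev_local m n V V _ q) ?radius_conclusion ?(negbTE concl) // => x i _ _.
rewrite [in RHS](divn_eq q L); elim: (q %/ L) => [|k ->] //.
by rewrite mulSn -!addnA (addnC L) VL.
Qed.

(** * Computable functions *)

(* Functions of a list of arguments, missing arguments being read as 0, so that
   binding a variable is consing and every arity is covered at once. *)
Definition computable (f : seq nat -> nat) : Prop :=
  forall n, exists p : recfun n, forall v : n.-tuple nat, computes p v (f v).

Lemma computable_ext f g : f =1 g -> computable f -> computable g.
Proof. by move=> fg cf n; have [p pf] := cf n; exists p => v; rewrite -fg. Qed.

Lemma computable_head : computable (head 0).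
Proof.
case=> [|n]; first by exists (RZero 0) => v; rewrite tuple0.
by exists (RProj ord0) => v /=; case/tupleP: v => x v; rewrite tnth0.
Qed.

Lemma computable_behead f :
  computable f -> computable (fun v => f (behead v)).
Proof.
move=> cf [|n]; first by have [p pf] := cf 0; exists p => v; have := pf v; rewrite tuple0.
have [p pf] := cf n; exists (RComp p (fun i => RProj (lift ord0 i))) => v /=.
exists [tuple of behead v]; split=> [i|]; last exact: pf.
by case/tupleP: v => x v; rewrite tnthS; congr (tnth _ i); apply/val_inj.
Qed.

Lemma computable_nth i : computable (fun v => head 0 (iter i behead v)).
Proof.
elim: i => [|i IH]; first exact: computable_head.
apply: computable_ext (computable_behead IH) => v.
by rewrite iterSr.
Qed.

Lemma computable_succ f : computable f -> computable (fun v => (f v).+1).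
Proof.
move=> cf n; have [p pf] := cf n.
exists (RComp RSucc (fun _ => p)) => v /=; exists [tuple f v]; split=> // i.
by rewrite ord1 tnth0.
Qed.

Lemma computable_const k : computable (fun => k).
Proof.
elim: k => [|k IH]; last exact: computable_succ.
by move=> n; exists (RZero n).
Qed.

Lemma computable_rec f g h : computable f -> computable h ->
  computable (fun v => g (head 0 v) (head 0 (behead v)) (behead (behead v))) ->
  computable (fun v => iteri (h v) (fun x w => g x w v) (f v)).
Proof.
move=> cf ch cg n; have [p pf] := cf n; have [q qg] := cg n.+2.
have [s sh] := ch n.
exists (RComp (RPrec p q)
  (fun i : 'I_n.+1 => if unlift ord0 i is Some j then RProj j else s)) => v /=.
exists [tuple of h v :: v]; split=> [i|].
  by case: unliftP => [j ->|->] /=; rewrite ?tnthS ?tnth0.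
have -> : [tuple of behead [tuple of h v :: v]] = v by apply/val_inj.
exists (fun k => iteri k (fun x w => g x w v) (f v)); split=> [|x _|].
- exact: pf.
- exact: qg.
- by rewrite theadE.
Qed.

Lemma computable_add f g :
  computable f -> computable g -> computable (fun v => f v + g v).
Proof.
move=> cf cg.
apply: computable_ext (computable_rec (g := fun _ w _ => w.+1) cg cf _).
  by move=> v; elim: (f v) => //= n ->.
exact: computable_succ (computable_nth 1).
Qed.

Lemma computable_mul f g :
  computable f -> computable g -> computable (fun v => f v * g v).
Proof.
move=> cf cg.
apply: computable_ext (computable_rec (g := fun _ w v => g v + w)
  (computable_const 0) cf _).
  by move=> v; elim: (f v) => //= n ->.
apply: computable_add (computable_nth 1).
exact: (computable_behead (computable_behead cg)).
Qed.

Lemma computable_pred f : computable f -> computable (fun v => (f v).-1).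
Proof.
move=> cf.
apply: computable_ext (computable_rec (g := fun x _ _ => x)
  (computable_const 0) cf _); first by move=> v; case: (f v).
exact: computable_nth 0.
Qed.

Lemma computable_sub f g :
  computable f -> computable g -> computable (fun v => f v - g v).
Proof.
move=> cf cg.
apply: computable_ext (computable_rec (g := fun _ w _ => w.-1) cf cg _).
  by move=> v; elim: (g v) => [|n]; rewrite ?subn0 //= subnS => ->.
exact: computable_pred (computable_nth 1).
Qed.

Lemma computable_exp2 f : computable f -> computable (fun v => 2 ^ f v).
Proof.
move=> cf.
apply: computable_ext (computable_rec (g := fun _ w _ => 2 * w)
  (computable_const 1) cf _).
  by move=> v; elim: (f v) => //= n ->; rewrite expnS.
exact: computable_mul (computable_const 2) (computable_nth 1).
Qed.

Lemma computable_odd f : computable f -> computable (fun v => odd (f v)).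
Proof.
move=> cf.
apply: computable_ext (computable_rec (g := fun _ w _ => 1 - w)
  (computable_const 0) cf _).
  by move=> v; elim: (f v) => //= n ->; case: odd.
exact: computable_sub (computable_const 1) (computable_nth 1).
Qed.

(** Uses that the half of [n.+1] is [n] minus the half of [n]. *)
Lemma computable_half f : computable f -> computable (fun v => (f v)./2).
Proof.
move=> cf.
apply: computable_ext (computable_rec (g := fun x w _ => x - w)
  (computable_const 0) cf _).
  move=> v; elim: (f v) => //= n ->.
  by rewrite -{1}(odd_double_half n) -addnn addnA addnK uphalf_half.
exact: computable_sub (computable_nth 0) (computable_nth 1).
Qed.

Lemma computable_and (f g : seq nat -> bool) :
  computable f -> computable g -> computable (fun v => f v && g v).
Proof.
move=> cf cg; apply: computable_ext (computable_mul cf cg) => v.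
exact: mulnb.
Qed.

Lemma computable_neg (f : seq nat -> bool) :
  computable f -> computable (fun v => ~~ f v).
Proof.
move=> cf; apply: computable_ext (computable_sub (computable_const 1) cf) => v.
by case: (f v).
Qed.

Lemma computable_or (f g : seq nat -> bool) :
  computable f -> computable g -> computable (fun v => f v || g v).
Proof.
move=> cf cg; apply: computable_ext (computable_neg (computable_and
  (computable_neg cf) (computable_neg cg))) => v.
by rewrite negb_and !negbK.
Qed.

Lemma computable_imp (f g : seq nat -> bool) :
  computable f -> computable g -> computable (fun v => f v ==> g v).
Proof.
move=> cf cg; apply: computable_ext (computable_or (computable_neg cf) cg) => v.
by rewrite implybE.
Qed.

Lemma computable_leq f g :
  computable f -> computable g -> computable (fun v => f v <= g v).
Proof.
move=> cf cg; apply: computable_ext (computable_sub (computable_const 1)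
  (computable_sub cf cg)) => v.
by rewrite /leq; case: (f v - g v).
Qed.

Lemma computable_eqn f g :
  computable f -> computable g -> computable (fun v => f v == g v).
Proof.
move=> cf cg; apply: computable_ext (computable_and
  (computable_leq cf cg) (computable_leq cg cf)) => v.
by rewrite eqn_leq.
Qed.

Lemma computable_eqb (f g : seq nat -> bool) :
  computable f -> computable g -> computable (fun v => f v == g v).
Proof.
move=> cf cg; apply: computable_ext (computable_eqn cf cg) => v.
by case: (f v); case: (g v).
Qed.

Lemma computable_all b (P : nat -> seq nat -> bool) : computable b ->
  computable (fun v => P (head 0 v) (behead v)) ->
  computable (fun v => all (fun x => P x v) (iota 0 (b v))).
Proof.
move=> cb cP; apply: computable_ext (computable_rec
  (g := fun x w v => w * P x v) (computable_const 1) cb _) => [v|].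
  elim: (b v) => // n IH; rewrite -[in RHS]addn1 iotaD all_cat /= IH mulnb.
  by rewrite add0n andbT.
apply: computable_mul (computable_nth 1) _.
(* The recursion passes its accumulator as second argument, and [P] must not see it. Arities 0 and 1
   are separate because missing arguments read as 0. *)
have := cP; clear; move=> cP [|[|n]].
- by have [p pP] := cP 0; exists p => v; have := pP v; rewrite tuple0.
- have [p pP] := cP 1; exists p => v; have := pP v.
  by case/tupleP: v => x v; rewrite (tuple0 v).
have [p pP] := cP n.+1.
exists (RComp p (fun i : 'I_n.+1 =>
  if unlift ord0 i is Some j then RProj (lift ord0 (lift ord0 j))
  else RProj ord0)) => v /=.
case/tupleP: v => x v; case/tupleP: v => y v.
exists [tuple of x :: v]; split=> [i|]; last exact: pP.
by case: unliftP => [j ->|->] /=; rewrite !tnthS || rewrite !tnth0.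
Qed.

Lemma computable_has b (P : nat -> seq nat -> bool) : computable b ->
  computable (fun v => P (head 0 v) (behead v)) ->
  computable (fun v => has (fun x => P x v) (iota 0 (b v))).
Proof.
move=> cb cP; apply: computable_ext (computable_neg (computable_all
  (P := fun x v => ~~ P x v) cb (computable_neg cP))) => v.
by rewrite -has_predC; congr (nat_of_bool _); apply: eq_has => x; rewrite /= negbK.
Qed.

(** A counter reset to 0 on reaching [g v]; for [g v = 0] it is never reset, in accordance with
    [modn0]. *)
Lemma computable_mod f g :
  computable f -> computable g -> computable (fun v => f v %% g v).
Proof.
move=> cf cg.
apply: computable_ext (computable_rec
  (g := fun _ w v => (w.+1 != g v) * w.+1) (computable_const 0) cf _).
  move=> v; elim: (f v) => [|n /= ->]; first by rewrite mod0n.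
  case: (posnP (g v)) => [-> |g0]; first by rewrite !modn0 mul1n.
  rewrite -[in RHS]addn1 -modnDml addn1.
  have := ltn_pmod n g0; rewrite leq_eqVlt; case: eqP => [->|_] /=.
    by rewrite modnn.
  by move=> lt; rewrite mul1n [RHS]modn_small.
apply: computable_mul; last exact: computable_succ (computable_nth 1).
apply: computable_neg; apply: computable_eqn.
  exact: computable_succ (computable_nth 1).
exact: (computable_behead (computable_behead cg)).
Qed.

Definition bit (T i : nat) : bool := odd (iter i half T).

Lemma computable_bit f g :
  computable f -> computable g -> computable (fun v => bit (f v) (g v)).
Proof.
move=> cf cg; apply: computable_odd.
apply: computable_ext (computable_rec (g := fun _ w _ => w./2) cf cg _).
  by move=> v; elim: (g v) => //= n ->.
exact: computable_half (computable_nth 1).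
Qed.

(** Every table of [n] bits has a number below [2 ^ n], so the search for a table is bounded. *)
Lemma bit_ex n (f : nat -> bool) :
  exists2 T, T < 2 ^ n & forall i, bit T i = (i < n) && f i.
Proof.
elim: n f => [|n IH] f.
  exists 0 => // i; rewrite /bit.
  by suff -> : iter i half 0 = 0 by []; elim: i => //= i ->.
have [T Tn TE] := IH (f \o succn).
exists (f 0 + T.*2) => [|[|i]].
- by rewrite expnS mul2n; case: (f 0); rewrite /= ?ltn_Sdouble ?ltn_double.
- by rewrite /bit /= oddD odd_double addbF; case: (f 0).
- by rewrite /bit iterSr half_bit_double; apply: TE.
Qed.

Lemma computable_cpair f g :
  computable f -> computable g -> computable (fun v => cpair (f v) (g v)).
Proof.
move=> cf cg; have cfg := computable_add cf cg.
exact: computable_add (computable_half (computable_mul cfg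
  (computable_succ cfg))) cg.
Qed.

(** Bound variables are list positions, as de Bruijn indices. Ten projections cover the code of the
    rule under the nine nested quantifiers of [refutation]. *)
Ltac prove_computable :=
  repeat (cbv beta; lazymatch goal with
  | |- computable (fun _ => ?k) => exact: (computable_const k)
  | |- computable (fun _ => nat_of_bool (all _ _)) => apply: computable_all
  | |- computable (fun _ => nat_of_bool (has _ _)) => apply: computable_has
  | |- computable (fun _ => nat_of_bool (andb _ _)) => apply: computable_and
  | |- computable (fun _ => nat_of_bool (orb _ _)) => apply: computable_or
  | |- computable (fun _ => nat_of_bool (implb _ _)) => apply: computable_imp
  | |- computable (fun _ => nat_of_bool (negb _)) => apply: computable_neg
  | |- computable (fun _ => nat_of_bool (bit _ _)) => apply: computable_bit
  | |- computable (fun _ => nat_of_bool (@eq_op _ _ _)) =>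
      first [apply: computable_eqb | apply: computable_eqn]
  | |- computable (fun _ => cpair _ _) => apply: computable_cpair
  | |- computable (fun _ => expn 2 _) => apply: computable_exp2
  | |- computable (fun _ => addn _ _) => apply: computable_add
  | |- computable (fun _ => muln _ _) => apply: computable_mul
  | |- computable (fun _ => modn _ _) => apply: computable_mod
  | |- computable (fun _ => S _) => apply: computable_succ
  | |- _ => first [ exact: (computable_nth 0) | exact: (computable_nth 1)
      | exact: (computable_nth 2) | exact: (computable_nth 3)
      | exact: (computable_nth 4) | exact: (computable_nth 5)
      | exact: (computable_nth 6) | exact: (computable_nth 7)
      | exact: (computable_nth 8) | exact: (computable_nth 9)]
  end).

(** * The decision procedure *)

(** Decoding is no part of the algorithm; it only serves to fill the table of a refutable rule, so
    an exhaustive search will do. *)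
Definition unpair (c : nat) : nat * nat :=
  head (0, 0) [seq p <- [seq (a, b) | a <- iota 0 c.+1, b <- iota 0 c.+1]
              | cpair p.1 p.2 == c].

Lemma unpairP c : unpair c = (0, 0) \/ cpair (unpair c).1 (unpair c).2 = c.
Proof.
rewrite /unpair; set s := filter _ _.
have : all (fun p => cpair p.1 p.2 == c) s by apply: filter_all.
by case: s => [|p s] /=; [left | case/andP => /eqP; right].
Qed.

Lemma cpairK a b : unpair (cpair a b) = (a, b).
Proof.
have [ale ble] := cpair_ge a b.
rewrite /unpair; set s := filter _ _.
have : (a, b) \in s.
  rewrite mem_filter eqxx andTb.
  by apply: (allpairs_f pair); rewrite mem_iota ltnS.
have : all (fun p => cpair p.1 p.2 == cpair a b) s by apply: filter_all.
case: s => // -[c d] s /= /andP[/eqP E _] _.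
by case: (cpair_inj E) => -> ->.
Qed.

Lemma unpair_le c : (unpair c).1 <= c /\ (unpair c).2 <= c.
Proof.
case: (unpairP c) => [->|E] //; rewrite -[X in _ <= X /\ _ <= X]E.
exact: cpair_ge.
Qed.

Lemma unpair_lt c : 0 < (unpair c).1 -> (unpair c).2 < c.
Proof.
case: (unpairP c) => [->|E] // lt; rewrite -[X in _ < X]E; exact: ltn_cpair.
Qed.

(** Total on numbers: tag 0 and the tags above 6 give letters. Fuel above [c] is enough, since a
    nonzero tag makes the components smaller than the code. *)
Fixpoint decode_fuel (k c : nat) : form :=
  if k is k'.+1 then
    let d := decode_fuel k' in
    let p := unpair c in
    let q := unpair p.2 in
    match p.1 with
    | 1 => Neg (d p.2)
    | 2 => And (d q.1) (d q.2)
    | 3 => Or (d q.1) (d q.2)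
    | 4 => Imp (d q.1) (d q.2)
    | 5 => Next (d p.2)
    | 6 => Since (d q.1) (d q.2)
    | _ => Var p.2
    end
  else Var 0.

Definition decode (c : nat) : form := decode_fuel c.+1 c.

Lemma decode_fuelE k c : c < k -> decode_fuel k c = decode c.
Proof.
suff H l : c < k -> c < l -> decode_fuel k c = decode_fuel l c.
  by move=> ck; apply: H.
elim: k l c => [|k IH] [|l] c //; rewrite !ltnS => ck cl /=.
have lt := @unpair_lt c.
have [q1 q2] := unpair_le (unpair c).2.
move: lt q1 q2; case: (unpair c) => [[|t] x] //= /(_ isT) xc q1 q2.
have I z : z <= x -> decode_fuel k z = decode_fuel l z.
  by move=> zx; apply: IH; apply: leq_trans (leq_ltn_trans zx xc) _.
by case: t => [|[|[|[|[|[|t]]]]]]; rewrite ?(I x) ?(I (unpair x).1) ?(I (unpair x).2).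
Qed.

Lemma decodeE t x : decode (cpair t x) = match t with
  | 1 => Neg (decode x)
  | 2 => And (decode (unpair x).1) (decode (unpair x).2)
  | 3 => Or (decode (unpair x).1) (decode (unpair x).2)
  | 4 => Imp (decode (unpair x).1) (decode (unpair x).2)
  | 5 => Next (decode x)
  | 6 => Since (decode (unpair x).1) (decode (unpair x).2)
  | _ => Var x
  end.
Proof.
have [x1 x2] := unpair_le x.
rewrite {1}/decode; move: (cpairK t x) (@ltn_cpair t x).
move: (cpair t x) => c E lt; rewrite /= E /=.
case: t {E} lt => //= t /(_ isT) xc.
have xE z : z <= x -> decode_fuel c z = decode z.
  by move=> zx; apply: decode_fuelE; apply: leq_ltn_trans xc.
by rewrite !xE.
Qed.

Lemma code_formK : cancel code_form decode.
Proof.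
elim=> [x|p IHp|p IHp q IHq|p IHp q IHq|p IHp q IHq|p IHp|p IHp q IHq] /=.
all: by rewrite decodeE ?cpairK ?IHp ?IHq.
Qed.

(** The truth clauses, imposed on arbitrary numbers [x] and [y], so that codes of formulas need not
    be recognised. Letters are unconstrained. *)
Definition coherent_at (m : nat) (t : nat -> nat -> bool) (x y a : nat) : bool :=
  [&& t (cpair 1 x) a == ~~ t x a,
      t (cpair 2 (cpair x y)) a == t x a && t y a,
      t (cpair 3 (cpair x y)) a == t x a || t y a,
      t (cpair 4 (cpair x y)) a == (t x a ==> t y a),
      t (cpair 5 x) a == t x (a + 1)
    & t (cpair 6 (cpair x y)) a == has (fun b => t y (a + b) &&
        all (fun c => t x (a + c)) (iota 0 b)) (iota 0 m.+1)].

Lemma cpair_le a b n : cpair a b <= n -> a <= n /\ b <= n.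
Proof. by have [al bl] := cpair_ge a b => le; split; apply: leq_trans le. Qed.

Lemma ev_coherent m t n phi a :
  (forall x y b, x <= n -> y <= n -> coherent_at m t x y b) ->
  code_form phi <= n ->
  ev m (fun x b => t (cpair 0 x) b) a phi = t (code_form phi) a.
Proof.
move=> tc; elim: phi a => [x|p IHp|p IHp q IHq|p IHp q IHq|p IHp q IHq|p IHp|p IHp q IHq] a //.
all: move=> /= /cpair_le[_ pn]; try have {pn} [pn qn] := cpair_le pn.
- by have /and5P[/eqP-> _ _ _ _] := tc _ 0 a pn (leq0n _); rewrite IHp.
- by have /and5P[_ /eqP-> _ _ _] := tc _ _ a pn qn; rewrite IHp ?IHq.
- by have /and5P[_ _ /eqP-> _ _] := tc _ _ a pn qn; rewrite IHp ?IHq.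
- by have /and5P[_ _ _ /eqP-> _] := tc _ _ a pn qn; rewrite IHp ?IHq.
- by have /and5P[_ _ _ _ /andP[/eqP-> _]] := tc _ 0 a pn (leq0n _); rewrite IHp ?addn1.
have /and5P[_ _ _ _ /andP[_ /eqP->]] := tc _ _ a pn qn.
rewrite -[LHS]/(has _ (iota 0 m.+1)); apply: eq_has => b.
by rewrite IHq //; congr andb; apply: eq_all => c; rewrite IHp.
Qed.

(* The number [T] tabulates the truth values of the formulas (by code) at the
   states of a cycle of length [L]. *)
Definition cell (T L c a : nat) : bool := bit T (c * L + a %% L).

Lemma cell_mod T L c a b : cell T L c (a %% L + b) = cell T L c (a + b).
Proof. by rewrite /cell modnDml. Qed.

(* The number [U] is the set of the codes of the final segments of the list of
   premises, which has code [P]; [Q] is the code of the conclusion. *)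
Definition certificate (m n L P Q T U : nat) : bool :=
  [&& all (fun x => all (fun y => all (fun a => coherent_at m (cell T L) x y a)
        (iota 0 L)) (iota 0 n.+1)) (iota 0 n.+1),
      all (fun x => all (fun a => cell T L (cpair 0 x) a == cell T L (cpair 0 x) 0)
        (iota 0 n.+1)) (iota 0 n.+1),
      has (fun a => ~~ cell T L Q a) (iota 0 L),
      bit U P
    & all (fun x => all (fun y => bit U (cpair x y).+1 ==>
        bit U y && all (fun a => cell T L x a) (iota 0 L))
        (iota 0 n.+1)) (iota 0 n.+1)].

(** For [x] and [y] up to [n], the largest code in a truth clause is [cpair 6 (cpair n n)]; this
    gives the number of rows of [T]. The codes in [U] are at most [n]. *)
Definition refutation (m n R : nat) : bool :=
  has (fun P => has (fun Q => (cpair P Q == R) &&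
    has (fun T => has (fun U => certificate m n (period n) P Q T U)
      (iota 0 (2 ^ n.+1)))
      (iota 0 (2 ^ ((cpair 6 (cpair n n)).+1 * period n))))
    (iota 0 R.+1)) (iota 0 R.+1).

Lemma all_iotaP (p : pred nat) n :
  reflect (forall i, i < n -> p i) (all p (iota 0 n)).
Proof.
by apply: (iffP allP) => H i; have := H i; rewrite mem_iota.
Qed.

Lemma has_iotaP (p : pred nat) n :
  reflect (exists2 i, i < n & p i) (has p (iota 0 n)).
Proof.
by apply: (iffP hasP) => -[i]; rewrite ?mem_iota => lt pi; exists i; rewrite ?mem_iota.
Qed.

Lemma coherent_mod m T L x y a :
  coherent_at m (cell T L) x y (a %% L) = coherent_at m (cell T L) x y a.
Proof.
have E c : cell T L c (a %% L) = cell T L c a by rewrite -[a %% L]addn0 cell_mod addn0.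
rewrite /coherent_at !E cell_mod; do 5!congr andb; congr (_ == _).
apply: eq_has => b; rewrite cell_mod; congr andb; apply: eq_all => c.
exact: cell_mod.
Qed.

Lemma leq_code_window m r : code_rule r <= window m r.
Proof. by rewrite /window mulSn leq_addr. Qed.

Lemma refutation_refutable m r :
  refutation m (window m r) (code_rule r) -> refutable m r.
Proof.
set n := window m r; set L := period n.
have L0 : 0 < L by apply: leq_ltn_trans (ltn_period n).
have Rn := leq_code_window m r.
case/has_iotaP => P _ /has_iotaP[Q _ /andP[/eqP E]].
have [-> -> {P Q E}] := cpair_inj E.
move=> /has_iotaP[T _ /has_iotaP[U _]].
case/and5P => /all_iotaP co /all_iotaP cst /has_iotaP[q _ concl] UP /all_iotaP UU.
have coh x y a : x <= n -> y <= n -> coherent_at m (cell T L) x y a.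
  move=> xn yn; rewrite -coherent_mod.
  by move: (co x xn) => /all_iotaP/(_ y yn)/all_iotaP; apply; apply: ltn_pmod.
have evE a phi : code_form phi <= n ->
    ev m (fun x b => cell T L (cpair 0 x) b) a phi = cell T L (code_form phi) a.
  by apply: ev_coherent coh.
exists (fun x b => cell T L (cpair 0 x) b); split.
- by move=> x a; rewrite /cell modnDr.
- by move=> x a xn an; have /all_iotaP/(_ a an)/eqP := cst x xn.
- move=> i a; rewrite evE; last first.
    exact: leq_trans (leq_code_premise i) Rn.
  (* Induction along the final segments: if [U] contains the code of a nonempty one, its head holds
     throughout the cycle and [U] contains the code of its tail. *)
  suff H s (j : 'I_(size s)) b : code_forms s <= n -> bit U (code_forms s) ->
      b < L -> cell T L (code_form (tnth (in_tuple s) j)) b.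
    rewrite -[a]add0n -[0 + a]addn0 -cell_mod addn0; apply: H UP (ltn_pmod _ L0).
    apply: leq_trans Rn.
    by case: (code_rule_ge r).
  rewrite (tnth_nth (Var 0)) /=; case: j => j /=.
  elim: s j => //= p s IH j js /ltnW/cpair_le[pn sn] Us bL.
  have /all_iotaP/(_ _ sn)/implyP/(_ Us)/andP[Us' /all_iotaP pT] := UU _ pn.
  by case: j js => [_|j js] /=; [apply: pT | apply: IH].
exists q; rewrite evE //; apply: leq_trans Rn.
by case: (code_rule_ge r).
Qed.

Lemma leq_cpair2 a b c d : a <= c -> b <= d -> cpair a b <= cpair c d.
Proof.
by move=> ac bd; rewrite /cpair leq_add // half_leq // leq_mul // ?ltnS leq_add.
Qed.

Lemma refutable_refutation m r :
  refutable m r -> refutation m (window m r) (code_rule r).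
Proof.
set n := window m r; set L := period n.
have nL : n < L by apply: ltnW (ltn_period n).
have L0 : 0 < L by apply: leq_ltn_trans nL.
have Rn : code_rule r <= n by apply: leq_code_window.
case=> V [VL Vc prem [q concl]].
have [Pr Qr] := code_rule_ge r.
pose C := cpair 6 (cpair n n).
(* Quotient and remainder by [L] recover the row and the column of a cell, which receives the actual
   truth value of the decoded formula. *)
have [T Tlt TE] := bit_ex (C.+1 * L) (fun i => ev m V (i %% L) (decode (i %/ L))).
have [U Ult UE] := bit_ex n.+1
  (fun c => has (fun k => code_forms (drop k (premises r)) == c)
     (iota 0 (size (premises r)).+1)).
have evL a phi : ev m V (a %% L) phi = ev m V a phi.
  apply: ev_local (leqnn _) _ => x i _ _.
  rewrite [in RHS](divn_eq a L); elim: (a %/ L) => [|k ->] //.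
  by move: VL; rewrite -/n -/L; move: (L) => l Vl; rewrite mulSn -!addnA (addnC l) Vl.
have cellE c a : c <= C -> cell T L c a = ev m V a (decode c).
  move=> cC; have aL := ltn_pmod a L0.
  rewrite /cell TE divnMDl // divn_small // addn0 modnMDl modn_mod evL.
  rewrite andb_idl // => _; rewrite mulSnr -addnS.
  by rewrite leq_add // leq_mul2r cC orbT.
have nC k x y : k <= 6 -> x <= n -> y <= n ->
    [/\ x <= C, cpair k x <= C & cpair k (cpair x y) <= C].
  move=> k6 xn yn; have [nn _] := cpair_ge n n; have [_ nC] := cpair_ge 6 (cpair n n).
  split; first exact: leq_trans xn (leq_trans nn nC).
    by apply: leq_cpair2 => //; apply: leq_trans nn.
  by apply: leq_cpair2 => //; apply: leq_cpair2.
have nn x : x <= n -> x <= C by move=> xn; case: (nC 0 x 0).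
apply/has_iotaP; exists (code_forms (premises r)) => //.
apply/has_iotaP; exists (code_form (conclusion r)) => //.
rewrite eqxx; apply/has_iotaP; exists T => //; apply/has_iotaP; exists U => //.
apply/and5P; split.
- apply/all_iotaP => x xn; apply/all_iotaP => y yn; apply/all_iotaP => a _.
  have c k : k <= 6 -> cpair k x <= C by move=> k6; case: (nC k x y).
  have d k : k <= 6 -> cpair k (cpair x y) <= C by move=> k6; case: (nC k x y).
  rewrite /coherent_at !cellE ?c ?d ?nn // !decodeE cpairK !eqxx addn1 eqxx.
  rewrite !andTb -[X in X == _]/(has _ (iota 0 m.+1)); apply/eqP; apply: eq_has => b.
  by rewrite cellE ?nn //; congr andb; apply: eq_all => e; rewrite cellE ?nn.
- apply/all_iotaP => x xn; apply/all_iotaP => a an.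
  by rewrite !cellE ?decodeE /= ?Vc //; case: (nC 0 x 0).
- apply/has_iotaP; exists (q %% L); first exact: ltn_pmod.
  by rewrite cellE ?nn ?(leq_trans Qr) // code_formK evL.
- rewrite UE ltnS (leq_trans Pr) //; apply/has_iotaP; exists 0 => //.
  by rewrite drop0.
apply/all_iotaP => x xn; apply/all_iotaP => y yn.
apply/implyP; rewrite !UE => /andP[_ /has_iotaP[k ks /eqP E]].
(* A successor code belongs to a nonempty segment, and injectivity of pairing identifies [x] and [y]
   with the codes of its head and tail. *)
case D: (drop k _) E => [|p s] //= [/cpair_inj[Ep Es]].
have ks' : k < size (premises r).
  by rewrite ltnNge; apply/negP => /drop_oversize; rewrite D.
rewrite yn andTb; apply/andP; split.
  apply/(has_iotaP _ (size (premises r)).+1); exists k.+1 => //.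
  rewrite -add1n -drop_drop D /= drop0.
  exact/eqP.
apply/all_iotaP => a _; rewrite cellE ?nn // -Ep code_formK.
have := prem (Ordinal ks') a; rewrite (tnth_nth (Var 0)) /=.
by rewrite -[k]addn0 -nth_drop D.
Qed.

Lemma computable_refutation m :
  computable (fun v => refutation m (m.+1 * head 0 v) (head 0 v)).
Proof.
rewrite /refutation /certificate /coherent_at /cell /period.
prove_computable.
Qed.

Theorem theorem3 (m : nat) :
  exists p : recfun 1, forall r : rule,
    (admissible (LTL_Past m) r -> computes p [tuple code_rule r] 1) /\
    (~ admissible (LTL_Past m) r -> computes p [tuple code_rule r] 0).
Proof.
have [p pE] := computable_neg (computable_refutation m) 1.
exists p => r; have := pE [tuple code_rule r]; rewrite /= -/(window m r).
case: (boolP (refutation _ _ _)) => [/refutation_refutable ref|nref] H.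
  by split=> // /(refutable_not_admissible ref).
split=> // /not_admissible_refutable/refutable_refutation.
by rewrite (negbTE nref).
Qed.
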